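(* Let $\{\mathcal{A},m_k\}$ be an $A_\infty$-algebra, let $\mathcal{B}$ be an $A_\infty$-module over $\mathcal{A}$, and let $A\in\mathcal{A}$ be an element of grading one. Let $m_1'$ be the operator defined by $m_1'(B)=\sum_{k\ge1}\delta_k\, m_k(A^{\otimes(k-1)}\otimes B)$, where $\delta_k=(-1)^{(k-1)(k-2)/2}$. Then $m_1'\circ m_1'=0$ if $m_1'(A)=0$.
   Context: An $A_\infty$-algebra is a $\mathbb{Z}$-graded vector space $\mathcal{A}=\bigoplus_{k\in\mathbb{Z}}\mathcal{A}^k$ endowed with graded linear maps $m_k:\mathcal{A}^{\otimes k}\to\mathcal{A}$, $k\ge1$, of degree $2-k$, satisfying for every $k\ge1$ $$\sum_{r+s+t=k}(-1)^{r+st}\,m_{r+t+1}(\mathbf{1}^{\otimes r}\otimes m_s\otimes\mathbf{1}^{\otimes t})=0\qquad (r,t\ge0,\ s\ge1).$$ An $A_\infty$-module over $\mathcal{A}$ is a $\mathbb{Z}$-graded vector space $\mathcal{B}$ with graded linear maps, also denoted $m_k:\mathcal{A}^{\otimes(k-1)}\otimes\mathcal{B}\to\mathcal{B}$, $k\ge1$, of degree $2-k$, satisfying the same relations on $\mathcal{A}^{\otimes(k-1)}\otimes\mathcal{B}$, where the inner $m_s$ is that of $\mathcal{A}$ if $t\ge1$ and that of $\mathcal{B}$ if $t=0$, and the outer map is that of $\mathcal{B}$. When tensor products of maps are applied to elements, the Koszul sign rule $(f\otimes g)(x\otimes y)=(-1)^{|g||x|}f(x)\otimes g(y)$ is used.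 Here $\delta_k=1$ for $k\equiv1,2\pmod 4$ and $\delta_k=-1$ for $k\equiv3,0\pmod 4$, so that for $B\in\mathcal{B}$ $$m_1'(B)=m_1(B)+m_2(A,B)-m_3(A,A,B)-m_4(A,A,A,B)+\cdots.$$ The element $m_1'(A)\in\mathcal{A}$ is given by the same formula using the operations of $\mathcal{A}$: $m_1'(A)=\sum_{k\ge1}\delta_k\,m_k(A^{\otimes k})$. The conclusion $m_1'\circ m_1'=0$ refers to $m_1'$ acting on $\mathcal{B}$.
   Formalization: Infinite sums are read as finite: m_k(A,…,A) and m_k(A,…,A,B) vanish for large k, and for each s and B only finitely many terms m(A^r, m_s(A^s), A^t, B) are nonzero; without the last condition the claim fails. All of this is automatic if m_k = 0 for large k. *)

(* Defs.v *)
From HB Require Import structures.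
From mathcomp Require Import all_boot all_order all_algebra.
From mathcomp Require Import boolp classical_sets functions cardinality fsbigop.

Set Implicit Arguments.
Unset Strict Implicit.
Unset Printing Implicit Defensive.

Import GRing.Theory.

Local Open Scope classical_set_scope.
Local Open Scope ring_scope.

(* V is the internal direct sum of the subspaces [homog d], d : int. *)
Record grading (K : fieldType) (V : lmodType K) := Grading {
  homog :> int -> set V;
  homog_lin : forall d (c : K) (x y : V),
    homog d x -> homog d y -> homog d (c *: x + y);
  homog0 : forall d, homog d 0;
  homog_span : forall v : V, exists (s : seq int) (c : int -> V),
    (forall d, homog d (c d)) /\ v = \sum_(d <- s) c d;
  homog_indep : forall (s : seq int) (c : int -> V),
    uniq s -> (forall d, homog d (c d)) -> \sum_(d <- s) c d = 0 ->
    forall d, d \in s -> c d = 0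
}.

Definition homogs (K : fieldType) (V : lmodType K) (gr : grading V)
    (ds : seq int) (xs : seq V) : Prop :=
  size ds = size xs /\
  forall i, (i < size xs)%N -> gr ds`_i xs`_i.

(* The sign (-1)^(r + s t) of the A_infinity relation, times the Koszul sign
   of moving m_s, of degree 2 - s, past r elements of degrees ds. *)
Definition ainf_sign (K : fieldType) (r s t : nat) (ds : seq int) : K :=
  (-1) ^+ (r + s * t) * (-1) ^ ((2%:Z - s%:Z) * \sum_(d <- ds) d).

(* All the m_k are packed in one function on sequences: m_k (x_1, ..., x_k) is
   [mu [:: x_1; ...; x_k]].  There is no m_0: the value of [mu [::]] is
   unconstrained and is never used. *)
Record ainf_algebra (K : fieldType) := AinfAlgebra {
  alg_space :> lmodType K;
  alg_gr : grading alg_space;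
  mu : seq alg_space -> alg_space;
  mu_multilinear : forall (c : K) (xs ys : seq alg_space) (x y : alg_space),
    mu (xs ++ (c *: x + y) :: ys) =
    c *: mu (xs ++ x :: ys) + mu (xs ++ y :: ys);
  mu_degree : forall (ds : seq int) (xs : seq alg_space),
    (1 <= size xs)%N -> homogs alg_gr ds xs ->
    alg_gr (\sum_(d <- ds) d + (2%:Z - (size xs)%:Z)) (mu xs);
  mu_relation : forall (k : nat) (ds : seq int) (xs : seq alg_space),
    (1 <= k)%N -> size xs = k -> homogs alg_gr ds xs ->
    \sum_(r < k.+1) \sum_(s < k.+1) \sum_(t < k.+1 |
        (1 <= s)%N && (r + s + t == k)%N)
      ainf_sign K r s t (take r ds) *:
        mu (take r xs ++ mu (take s (drop r xs)) :: drop (r + s) xs) = 0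
}.

(* m_k (x_1, ..., x_(k-1), b) is [act [:: x_1; ...; x_(k-1)] b], for k >= 1.
   No degree of b enters the signs, since no map is moved past b. *)
Record ainf_module (K : fieldType) (V : ainf_algebra K) := AinfModule {
  mod_space :> lmodType K;
  mod_gr : grading mod_space;
  act : seq V -> mod_space -> mod_space;
  act_linear : forall (c : K) (xs : seq V) (b b' : mod_space),
    act xs (c *: b + b') = c *: act xs b + act xs b';
  act_multilinear : forall (c : K) (xs ys : seq V) (x y : V) (b : mod_space),
    act (xs ++ (c *: x + y) :: ys) b =
    c *: act (xs ++ x :: ys) b + act (xs ++ y :: ys) b;
  act_degree : forall (ds : seq int) (xs : seq V) (e : int) (b : mod_space),
    homogs (alg_gr V) ds xs -> mod_gr e b ->
    mod_gr (\sum_(d <- ds) d + e + (2%:Z - (size xs).+1%:Z)) (act xs b);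
  act_relation : forall (k : nat) (ds : seq int) (xs : seq V) (b : mod_space),
    (1 <= k)%N -> size xs = k.-1 -> homogs (alg_gr V) ds xs ->
    \sum_(r < k.+1) \sum_(s < k.+1) \sum_(t < k.+1 |
        (1 <= s)%N && (r + s + t == k)%N)
      ainf_sign K r s t (take r ds) *:
        (if (1 <= t)%N
         then act (take r xs ++ mu (take s (drop r xs)) :: drop (r + s) xs) b
         else act (take r xs) (act (drop r xs) b)) = 0
}.

Definition delta (K : fieldType) (k : nat) : K :=
  (-1) ^+ ((k.-1 * k.-2)./2).

(* The sums below are sums of finitely supported families (and are 0 by
   convention when the support is infinite). *)
Definition alg_m1' (K : fieldType) (V : ainf_algebra K) (A : V) : V :=
  \sum_(k \in [set k : nat | (1 <= k)%N]) delta K k *: mu (nseq k A).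

Definition mod_m1' (K : fieldType) (V : ainf_algebra K) (W : ainf_module V)
    (A : V) (b : W) : W :=
  \sum_(k \in [set k : nat | (1 <= k)%N]) delta K k *: act (nseq k.-1 A) b.

(* The infinite sums make sense in vector spaces without topology: those that
   define m_1'(A) and m_1'(b), and, for each s, the sum over r and t of the
   terms m_(r+t+2) (A^r, m_s (A^s), A^t, b) of the relations evaluated on
   (A, ..., A, b).  The third condition does not follow from the first two,
   and m_1' need not square to 0 without it. *)
Definition summable_at (K : fieldType) (V : ainf_algebra K)
    (W : ainf_module V) (A : V) : Prop :=
  [/\ finite_set [set k : nat | (1 <= k)%N /\ mu (nseq k A) <> 0],
      forall b : W,
        finite_set [set k : nat | (1 <= k)%N /\ act (nseq k.-1 A) b <> 0]
    & forall (s : nat) (b : W), (1 <= s)%N ->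
        finite_set [set rt : nat * nat |
          act (nseq rt.1 A ++ mu (nseq s A) :: nseq rt.2 A) b <> 0]].

(* Main.v *)
(* Put A in every algebra slot of the module relations. Weighting the relation
   of arity k by (-1)^(C(k,2) + k - 1) turns the sign of the (r, s, t) term into
   delta_(r+t+1) delta_s (-1)^t. Summed over k, the terms with t = 0 give
   m_1'(m_1'(b)); for fixed r and t >= 1 those summed over s give a multiple of
   m_(r+t+1)(A^r, m_1'(A), A^(t-1), b), which is 0. Summability makes the whole
   family of terms finitely supported, which permits the exchange of sums. *)
Require Import Defs.
From HB Require Import structures.
From mathcomp Require Import all_boot all_order all_algebra.
From mathcomp Require Import boolp classical_sets functions cardinality fsbigop.
From mathcomp Require Import zify.

Set Implicit Arguments.
Unset Strict Implicit.
Unset Printing Implicit Defensive.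

Import GRing.Theory.

Local Open Scope ring_scope.

(** * Finite supports and rearrangement of finite sums *)

Lemma finite_set_bounded (T : eqType) (f : T -> nat) (X : set T) :
  finite_set X -> exists N, forall x, (N <= f x)%N -> ~ X x.
Proof.
move=> /finite_seqP[s ->]; exists (\max_(x <- s) f x).+1 => x lt_fx /= xs.
by have := leq_bigmax_seq (F := f) x xs isT; rewrite leqNgt lt_fx.
Qed.

(** From the threshold [N] of the second hypothesis on, [P s x] holds without any bound on [x]; the
    maximum of the finitely many bounds for [s < N] therefore serves for all [s]. *)
Lemma bounded_uniform (T : Type) (f : T -> nat) (P : nat -> T -> Prop) :
    (forall s, exists N, forall x, (N <= f x)%N -> P s x) ->
    (exists N, forall s, (N <= s)%N -> forall x, P s x) ->
  exists N, forall s x, (N <= f x)%N -> P s x.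
Proof.
move=> /choice[g Pg] [N PN]; exists (\max_(s < N) g s) => s x le_fx.
have [/PN //|lt_sN] := leqP N s.
by apply/Pg/(leq_trans _ le_fx)/(leq_bigmax (Ordinal lt_sN)).
Qed.

Lemma sum_ord_trunc (V : nmodType) (m n : nat) (f : nat -> V) :
    (m <= n)%N -> (forall i, (m <= i)%N -> f i = 0) ->
  \sum_(i < n) f i = \sum_(i < m) f i.
Proof.
move=> le_mn f0; rewrite (big_ord_widen n f le_mn).
rewrite [LHS](bigID (fun i : 'I_n => (i < m)%N)) /=.
by rewrite [X in _ + X]big1 ?addr0 // => i; rewrite -leqNgt => /f0.
Qed.

Lemma fsum_pos (V : nmodType) (N : nat) (f : nat -> V) :
    (forall k, (N <= k)%N -> f k.+1 = 0) ->
  \sum_(k \in [set k : nat | (1 <= k)%N]) f k = \sum_(k < N) f k.+1.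
Proof.
move=> f0; rewrite (fsbigE (iota 1 N)) ?iota_uniq //=.
- rewrite -[1%N]addn0 iotaDl big_map -{1}(subn0 N) big_mkord.
  by apply: eq_bigl => i; apply/mem_set.
- by move=> k /=; rewrite mem_iota => /andP[].
- by move=> [//|k] _; rewrite mem_iota /= add1n ltnS -leqNgt => /f0.
Qed.

Lemma linear_comb (K : fieldType) (U V : lmodType K) (f : U -> V) :
    linear f -> forall n (c : 'I_n -> K) (x : 'I_n -> U),
  f (\sum_i c i *: x i) = \sum_i c i *: f (x i).
Proof.
move=> lin_f n c x.
pose g : {linear U -> V} := HB.pack f (GRing.isLinear.Build K U V _ f lin_f).
by rewrite -[f]/(g : _ -> _) linear_sum; apply: eq_bigr => i _; rewrite linearZ.
Qed.

Lemma linear_at0 (K : fieldType) (U V : lmodType K) (f : U -> V) :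
  linear f -> f 0 = 0.
Proof.
by move=> lin_f; have := linear_comb lin_f (fun=> 0) (fun _ : 'I_0 => 0);
  rewrite !big_ord0.
Qed.

(** Each triple lies on exactly one diagonal [r + s.+1 + t = k], and those with [k >= M] contribute
    nothing, so the sum over the box splits into the vanishing diagonal sums for [k < M]. *)
Lemma sum_diagonals (V : nmodType) (M : nat) (G : nat -> nat -> nat -> V) :
    (forall k, (0 < k)%N ->
       \sum_(r < k.+1) \sum_(s < k.+1) \sum_(t < k.+1 |
         (1 <= s)%N && (r + s + t == k)%N) G r s t = 0) ->
    (forall r s t, (M <= r + s.+1 + t)%N -> G r s.+1 t = 0) ->
  \sum_(r < M) \sum_(s < M) \sum_(t < M) G r s.+1 t = 0.
Proof.
move=> Gdiag Gsupp.
pose H k r s t := if (r + s.+1 + t == k)%N then G r s.+1 t else 0.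
have HG r s t : G r s.+1 t = \sum_(k < M) H k r s t.
  have [/Gsupp G0|lt_M] := leqP M (r + s.+1 + t).
    by rewrite big1 /H // => k _; case: ifP.
  rewrite (bigD1 (Ordinal lt_M)) //= big1 ?addr0 /H ?eqxx // => k neq_k.
  by case: ifP => // /eqP eq_k; case/eqP: neq_k; apply: val_inj.
transitivity (\sum_(k < M) \sum_(r < M) \sum_(s < M) \sum_(t < M) H k r s t).
  rewrite [RHS]exchange_big; apply: eq_bigr => r _.
  rewrite [RHS]exchange_big; apply: eq_bigr => s _.
  by rewrite [RHS]exchange_big; apply: eq_bigr => t _; apply: HG.
(* The diagonal 0 is empty, because the middle index is at least 1. *)
apply: big1 => -[[|k] /= lt_kM] _.
  by do 3! [apply: big1 => ? _]; rewrite /H addnS.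
have H0 r s t : [|| k.+1 < r, k < s | k.+1 < t]%N -> H k.+1 r s t = 0.
  by rewrite /H; case: ifP => // /eqP; lia.
rewrite -[RHS](Gdiag k.+1) //.
rewrite (@sum_ord_trunc _ k.+2 M
  (fun r => \sum_(s < M) \sum_(t < M) H k.+1 r s t)) //; last first.
  by move=> i lt_i; do 2! [apply: big1 => ? _]; apply: H0; rewrite lt_i.
(* The empty slice [s = 0] of the relation is dropped, which aligns its middle index with the
   shifted one of the box. *)
apply: eq_bigr => r _; rewrite [RHS]big_ord_recl [X in X + _]big_pred0 // add0r.
rewrite (@sum_ord_trunc _ k.+1 M (fun s => \sum_(t < M) H k.+1 r s t)); first 1 last.
- exact: ltnW.
- by move=> i lt_i; apply: big1 => ? _; apply: H0; rewrite lt_i orbT.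
apply: eq_bigr => s _; rewrite (@sum_ord_trunc _ k.+2 M (H k.+1 r s)) //; last first.
  by move=> i lt_i; apply: H0; rewrite lt_i !orbT.
by rewrite [RHS]big_mkcond.
Qed.

(** * Signs *)

Lemma bin2D (m n : nat) : 'C(m + n, 2) = ('C(m, 2) + 'C(n, 2) + m * n)%N.
Proof.
elim: m => [|m IHm]; first by rewrite mul0n addn0.
by rewrite addSn !binS IHm !bin1; lia.
Qed.

Lemma deltaS (K : fieldType) (n : nat) : delta K n.+1 = (-1) ^+ 'C(n, 2).
Proof. by rewrite bin2. Qed.

(** With all degrees equal to 1, the Koszul factor is (-1)^((2 - s) r). The even part 2r of the
    exponent drops out, and negating s r does not change the sign. *)
Lemma ainf_sign_nseq1 (K : fieldType) (r s t : nat) :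
  ainf_sign K r s t (nseq r 1) = (-1) ^+ (r + s * (r + t)).
Proof.
have -> : ainf_sign K r s t (nseq r 1) =
          (-1) ^+ (r + s * t) * (-1) ^ ((2%:Z - s%:Z) * r%:Z).
  congr (_ * _ ^ (_ * _)); elim: r => [|r IHr]; first by rewrite big_nil.
  by rewrite big_cons IHr; lia.
have -> : (2%:Z - s%:Z) * r%:Z = 2%:Z * r%:Z - (s * r)%N%:Z by lia.
have unitN1 : (-1 : K) \is a GRing.unit by rewrite unitrN1.
rewrite exprzDr // -exprz_exp [(-1) ^ 2](sqrr_sign _ 1) exp1rz mul1r.
rewrite -invr_expz -exprnP invr_sign.
by rewrite -exprD mulnDr; congr (_ ^+ _); lia.
Qed.

(** By [bin2D], C(r + s + 1 + t, 2) = C(r + t, 2) + C(s, 2) + s + (r + t)(s + 1). On the right-hand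
    side (r + t)(s + 1), r and s then each occur twice, so modulo 2 only C(r + t, 2) + C(s, 2) + t
    survives. *)
Lemma delta_ainf_sign (K : fieldType) (r s t : nat) :
  delta K (r + t).+1 * delta K s.+1 * (-1) ^+ t =
  (-1) ^+ ('C(r + s.+1 + t, 2) + (r + s + t)) * ainf_sign K r s.+1 t (nseq r 1).
Proof.
rewrite ainf_sign_nseq1 !deltaS -!exprD -[LHS]signr_odd -[RHS]signr_odd.
congr (_ ^+ nat_of_bool _).
have -> : (r + s.+1 + t = (r + t) + (s + 1))%N by lia.
rewrite (bin2D (r + t)) (bin2D s) (@bin_small 1) // muln1.
rewrite -[s.+1]addn1 !(oddD, oddM) /=.
by case: (odd r); case: (odd s); case: (odd t); case: (odd _); case: (odd _).
Qed.

(** * The module relations evaluated on copies of [A] *)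

Section MaurerCartan.
Variables (K : fieldType) (V : ainf_algebra K) (W : ainf_module V).

Lemma act0 (xs : seq V) : act xs (0 : W) = 0.
Proof. by apply: (linear_at0 (f := act xs)) => c b b'; apply: act_linear. Qed.

Lemma act_slot_linear (xs ys : seq V) (b : W) :
  linear (fun x => act (xs ++ x :: ys) b).
Proof. by move=> c x y; apply: act_multilinear. Qed.

(** The element [b] fills the last slot: it takes one of the [t] places after the inner map if
    [t >= 1], and one of the [s] places inside it if [t = 0]. Hence the predecessors. *)
Definition act_term (A : V) (b : W) (r s t : nat) : W :=
  if (1 <= t)%N then act (nseq r A ++ mu (nseq s A) :: nseq t.-1 A) b
  else act (nseq r A) (act (nseq s.-1 A) b).

Definition signed_term (A : V) (b : W) (r s t : nat) : W :=
  (delta K (r + t).+1 * delta K s * (-1) ^+ t) *: act_term A b r s t.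

Lemma signed_relation (A : V) (b : W) (k : nat) : alg_gr V 1 A -> (0 < k)%N ->
  \sum_(r < k.+1) \sum_(s < k.+1) \sum_(t < k.+1 |
    (1 <= s)%N && (r + s + t == k)%N) signed_term A b r s t = 0.
Proof.
move=> degA k_gt0.
have homA : homogs (alg_gr V) (nseq k.-1 1) (nseq k.-1 A).
  by split=> [|i]; rewrite !size_nseq // => lt_i; rewrite !nth_nseq lt_i.
have := act_relation b k_gt0 (size_nseq _ _) homA.
move/(congr1 (fun w => (-1) ^+ ('C(k, 2) + k.-1) *: w)).
rewrite scaler0 => rel0; rewrite -[RHS]rel0 {rel0}.
rewrite scaler_sumr; apply: eq_bigr => -[r /= _] _.
rewrite scaler_sumr; apply: eq_bigr => -[s /= _] _.
rewrite scaler_sumr; apply: eq_bigr => -[t /= _] /andP[].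
(* The side condition excludes [s = 0]; from here on [s] stands for the arity of the inner map minus
   1. *)
case: s => // s _ /eqP eq_k; rewrite scalerA take_nseq; last by lia.
have -> : k.-1 = (r + s + t)%N by lia.
rewrite -{1}eq_k -delta_ainf_sign /signed_term /act_term; congr (_ *: _).
case: t {eq_k} => [|t] /=.
  by rewrite drop_nseq take_nseq ?addn0 ?addKn ?leq_addr.
rewrite !drop_nseq !take_nseq; [|lia..].
by congr (act (_ ++ _ :: nseq _ _) _); lia.
Qed.

Lemma mod_m1'_trunc (A : V) (b : W) (N : nat) :
    (forall k, (N <= k)%N -> act (nseq k A) b = 0) ->
  mod_m1' A b = \sum_(k < N) delta K k.+1 *: act (nseq k A) b.
Proof. by move=> act_0; apply: fsum_pos => k /act_0 ->; rewrite scaler0. Qed.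

Lemma alg_m1'_trunc (A : V) (N : nat) :
    (forall k, (N <= k)%N -> mu (nseq k.+1 A) = 0) ->
  alg_m1' A = \sum_(k < N) delta K k.+1 *: mu (nseq k.+1 A).
Proof. by move=> mu_0; apply: fsum_pos => k /mu_0 ->; rewrite scaler0. Qed.

Lemma signed_terms_sum0 (A : V) (b : W) (M : nat) : alg_gr V 1 A ->
    (forall r s t, (M <= r + s.+1 + t)%N -> act_term A b r s.+1 t = 0) ->
  \sum_(r < M) \sum_(s < M) \sum_(t < M) signed_term A b r s.+1 t = 0.
Proof.
move=> degA supp; apply: (sum_diagonals (G := signed_term A b)).
  by move=> k; apply: signed_relation.
by move=> r s t /supp; rewrite /signed_term => ->; rewrite scaler0.
Qed.

(** The operation is linear in the slot after the first [r] copies of [A], so it vanishes when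
    m_1'(A) = 0 is put there. Expanding m_1'(A) gives this sum, up to a sign independent of [s]. *)
Lemma insertion_terms_sum0 (A : V) (b : W) (r t M : nat) : alg_m1' A = 0 ->
    (forall s, (M <= s)%N -> mu (nseq s.+1 A) = 0) ->
  \sum_(s < M) signed_term A b r s.+1 t.+1 = 0.
Proof.
move=> hMC mu_0; have lin := act_slot_linear (nseq r A) (nseq t A) b.
have := linear_at0 lin; rewrite -hMC (alg_m1'_trunc mu_0) (linear_comb lin).
move/(congr1 (fun w => (delta K (r + t.+1).+1 * (-1) ^+ t.+1) *: w)).
rewrite scaler0 => /= sum0; rewrite -[RHS]sum0 scaler_sumr; apply: eq_bigr => s _.
by rewrite scalerA /signed_term /act_term /=; congr (_ *: _); rewrite mulrAC.
Qed.

(** Provides a single cutoff for all the sums. The last two clauses are uniform in [j] and in [s],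
    which summability states only for each value separately. *)
Lemma summable_bound (A : V) (b : W) : summable_at W A -> exists N,
  [/\ forall s, (N <= s)%N -> mu (nseq s.+1 A) = 0,
      forall i, (N <= i)%N -> act (nseq i A) b = 0,
      forall i, (N <= i)%N -> act (nseq i A) (mod_m1' A b) = 0,
      forall i j, (N <= i)%N -> act (nseq i A) (act (nseq j A) b) = 0
    & forall r s t, (N <= r + t)%N ->
        act (nseq r A ++ mu (nseq s.+1 A) :: nseq t A) b = 0].
Proof.
case=> fin_mu fin_act fin_ins.
have mu_bound : exists N, forall s, (N <= s)%N -> mu (nseq s.+1 A) = 0.
  have [N PN] := finite_set_bounded id fin_mu; exists N => s le_s.
  by apply: contrapT => nz; apply: (PN s.+1); rewrite //= ltnW.
have act_bound (b' : W) :
    exists N, forall i, (N <= i)%N -> act (nseq i A) b' = 0.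
  have [N PN] := finite_set_bounded id (fin_act b'); exists N => i le_i.
  by apply: contrapT => nz; apply: (PN i.+1); rewrite //= ltnW.
have [N1 P1] := mu_bound; have [N2 P2] := act_bound b.
have [N3 P3] := act_bound (mod_m1' A b).
(* For [j >= N2] the inner value is already 0, so only finitely many [j] need a bound of their
   own. *)
have [N4 P4] : exists N, forall j i, (N <= i)%N ->
    act (nseq i A) (act (nseq j A) b) = 0.
  apply: (bounded_uniform (f := id)) => [j|]; first exact: act_bound.
  by exists N2 => j /P2 -> i; rewrite act0.
(* Likewise, for [s >= N1] the inserted element is 0; the third summability condition handles each
   remaining [s]. *)
have [N5 P5] : exists N, forall s (rt : nat * nat), (N <= rt.1 + rt.2)%N ->
    act (nseq rt.1 A ++ mu (nseq s.+1 A) :: nseq rt.2 A) b = 0.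
  apply: (bounded_uniform (f := fun rt : nat * nat => (rt.1 + rt.2)%N)).
    move=> s; have [N PN] := finite_set_bounded (fun rt => (rt.1 + rt.2)%N)
      (fin_ins s.+1 b isT).
    by exists N => rt /PN /contrapT.
  by exists N1 => s /P1 -> rt; apply: (linear_at0 (act_slot_linear _ _ b)).
exists (N1 + N2 + N3 + N4 + N5)%N; split=> *.
- by apply: P1; lia.
- by apply: P2; lia.
- by apply: P3; lia.
- by apply: P4; lia.
- by apply: (P5 _ (_, _)) => /=; lia.
Qed.

End MaurerCartan.

Theorem theorem2p3 (K : fieldType) (V : ainf_algebra K) (W : ainf_module V)
    (A : V) (hA : alg_gr V 1 A) (hsum : summable_at W A)
    (hMC : alg_m1' A = 0) :
  forall B : W, mod_m1' A (mod_m1' A B) = 0.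
Proof.
move=> b; have [N [mu_0 act_0 m1act_0 act2_0 ins_0]] := summable_bound b hsum.
(* The tightest case is that of an insertion: from [s < N] and 2N + 1 <= r + (s + 1) + (t + 1)
   follows r + t >= N, as [ins_0] requires. *)
pose n := (2 * N)%N; have le_Nn : (N <= n.+1)%N by rewrite /n; lia.
have supp r s t : (n.+1 <= r + s.+1 + t)%N -> act_term A b r s.+1 t = 0.
  rewrite /act_term; case: t => [|t] /= le_n.
    have [/act_0 ->|lt_s] := leqP N s; first by rewrite act0.
    by apply: act2_0; rewrite /n in le_n; lia.
  have [/mu_0 ->|lt_s] := leqP N s.
    exact: (linear_at0 (act_slot_linear _ _ b)).
  by apply: ins_0; rewrite /n in le_n; lia.
rewrite -[RHS](signed_terms_sum0 hA supp).
rewrite (@mod_m1'_trunc _ _ _ _ _ n.+1) => [|k le_k]; last first.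
  by apply: m1act_0; lia.
(* The slice [t = 0] is split off. In the rest, [s] becomes the inner index, so that each inner sum
   is an insertion of m_1'(A). *)
apply: eq_bigr => r _; under [RHS]eq_bigr do rewrite big_ord_recl.
rewrite big_split /= exchange_big /= [X in _ + X]big1 ?addr0; last first.
  move=> t _; apply: insertion_terms_sum0 => // s le_s; apply: mu_0; lia.
rewrite (@mod_m1'_trunc _ _ _ _ _ n.+1) => [|k le_k]; last first.
  by apply: act_0; lia.
(* The slice [t = 0] is the outer operation applied termwise to the truncated sum for m_1'(b). *)
rewrite (linear_comb (f := act (nseq r A))); last first.
  by move=> c x y; apply: act_linear.
rewrite scaler_sumr; apply: eq_bigr => s _.
by rewrite scalerA /signed_term /act_term /= addn0 mulr1.
Qed.
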